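(* For every $n\ge 3$, $$s_n^k(132,231,321)=\begin{cases}1 & \text{if } 0\le k\le n-2,\\ 0 & \text{if } k=n-1,\\ 1 & \text{if } k=n.\end{cases}$$
   Context: $S_n$ denotes the set of permutations of $\{1,\dots,n\}$ written in one-line notation $\pi=\pi_1\pi_2\cdots\pi_n$. For $\alpha\in S_m$, $\pi\in S_n$ contains the pattern $\alpha$ if there are indices $i_1<i_2<\dots<i_m$ such that $\pi_{i_1}\pi_{i_2}\cdots\pi_{i_m}$ is order-isomorphic to $\alpha$; otherwise $\pi$ avoids $\alpha$. For a set $T$ of patterns, $S_n^k(T)$ is the set of $\pi\in S_n$ that have exactly $k$ fixed points (indices $i$ with $\pi_i=i$) and avoid every pattern in $T$; $s_n^k(T)=|S_n^k(T)|$. The braces around $T$ are omitted, e.g. $s_n^k(132,231,321)=s_n^k(\{132,231,321\})$. *)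

(* Defs.v *)
From mathcomp Require Import all_boot all_fingroup.

Set Implicit Arguments.
Unset Strict Implicit.
Unset Printing Implicit Defensive.

(* 'S_n permutes {0, .., n-1} instead of {1, .., n}: the shift by one on both
   positions and values preserves order-isomorphism and fixed points. Only the
   words given to [oneline] and [pat] use the values 1, .., n. *)

Lemma oneline_bounds (w : seq nat) (w_perm : perm_eq w (iota 1 (size w)))
  (i : 'I_(size w)) : 0 < nth 0 w i <= size w.
Proof.
have := mem_nth 0 (ltn_ord i).
by rewrite (perm_mem w_perm) mem_iota add1n ltnS.
Qed.

Lemma oneline_subproof (w : seq nat) (w_perm : perm_eq w (iota 1 (size w)))
  (i : 'I_(size w)) : (nth 0 w i).-1 < size w.
Proof. by case/andP: (oneline_bounds w_perm i); case: (nth 0 w i). Qed.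

Definition oneline_fun (w : seq nat) (w_perm : perm_eq w (iota 1 (size w)))
  (i : 'I_(size w)) : 'I_(size w) := Ordinal (oneline_subproof w_perm i).

Lemma oneline_fun_inj (w : seq nat) (w_perm : perm_eq w (iota 1 (size w))) :
  injective (oneline_fun w_perm).
Proof.
have w_uniq : uniq w by rewrite (perm_uniq w_perm) iota_uniq.
move=> i j /(congr1 val) /= eq_ij; apply/val_inj/eqP.
rewrite -(nth_uniq 0 (ltn_ord i) (ltn_ord j) w_uniq); apply/eqP.
case/andP: (oneline_bounds w_perm i) => i_gt0 _.
case/andP: (oneline_bounds w_perm j) => j_gt0 _.
by rewrite -(prednK i_gt0) -(prednK j_gt0) eq_ij.
Qed.

Definition oneline (w : seq nat) (w_perm : perm_eq w (iota 1 (size w))) :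
  'S_(size w) := perm (@oneline_fun_inj w w_perm).

Lemma onelineE (w : seq nat) (w_perm : perm_eq w (iota 1 (size w)))
  (i : 'I_(size w)) : (oneline w_perm i).+1 = nth 0 w i.
Proof.
by rewrite permE /= prednK //; case/andP: (oneline_bounds w_perm i).
Qed.

Definition contains (m n : nat) (alpha : 'S_m) (pi : 'S_n) : bool :=
  [exists f : {ffun 'I_m -> 'I_n},
    [forall a : 'I_m, forall b : 'I_m, (a < b) ==> (f a < f b)] &&
    [forall a : 'I_m, forall b : 'I_m,
       (pi (f a) < pi (f b)) == (alpha a < alpha b)]].

Definition avoids (m n : nat) (alpha : 'S_m) (pi : 'S_n) : bool :=
  ~~ contains alpha pi.

Definition pattern : Type := {m : nat & 'S_m}.

Definition pat (w : seq nat) (w_perm : perm_eq w (iota 1 (size w))) : pattern :=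
  existT (fun m : nat => 'S_m) (size w) (oneline w_perm).

Definition fixed_points (n : nat) (pi : 'S_n) : {set 'I_n} :=
  [set i | pi i == i].

Definition Snk (n k : nat) (T : seq pattern) : {set 'S_n} :=
  [set pi : 'S_n | (#|fixed_points pi| == k) &&
                   all (fun alpha => avoids (projT2 alpha) pi) T].

Definition snk (n k : nat) (T : seq pattern) : nat := #|Snk n k T|.

Definition p132 : pattern := @pat [:: 1; 3; 2] isT.
Definition p231 : pattern := @pat [:: 2; 3; 1] isT.
Definition p321 : pattern := @pat [:: 3; 2; 1] isT.

(* Main.v *)
Require Import Defs.
From mathcomp Require Import all_boot all_fingroup zify.

(** Let [pi] be a permutation of [{0, .., m}]. Each of the words 132, 231, 321
    ends with a descent, preceded by one more letter, so an occurrence of any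
    of them exhibits a descent between two positive positions. Conversely, when
    [0 < b < c] and [pi c < pi b], the letters at positions [0, b, c] form
    321, 231 or 132 according to where [pi 0] lies relative to [pi c < pi b].
    Hence avoiding the three patterns together means being increasing on the
    positive positions ([avoids3_increasing_tail]).

    Such a permutation is determined by its first letter [j]
    ([increasing_tail_inj]): it is the word [j 0 1 .. j-1 j+1 .. m], that is
    [lift_perm ord0 j 1]. It is the identity for [j = 0]; for [j > 0] its
    fixed points are exactly the positions beyond [j], so there are [m - j] of
    them ([card_fixed_points_lift_perm]). When [j] runs over [1, .., m] the
    number [m - j] takes each value of [0, .., m - 1] once, and [j = 0] gives
    the value [m + 1]; the value [m] is never taken. *)

Set Implicit Arguments.
Unset Strict Implicit.
Unset Printing Implicit Defensive.

Lemma oneline_ltn (w : seq nat) (w_perm : perm_eq w (iota 1 (size w)))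
    (i j : 'I_(size w)) :
  (oneline w_perm i < oneline w_perm j) = (nth 0 w i < nth 0 w j).
Proof. by rewrite -ltnS !onelineE. Qed.

Lemma ltn_perm_antisym n (pi : 'S_n) (i j : 'I_n) :
  i != j -> (pi j < pi i) = ~~ (pi i < pi j).
Proof.
rewrite -(inj_eq (@perm_inj _ pi)) -(inj_eq val_inj) /=.
by case: ltngtP.
Qed.

(** Comparing the letters in the order of their positions suffices: the reverse
    comparisons follow since both words have distinct letters. *)
Lemma contains3P n (x y z : nat) (w_perm : perm_eq [:: x; y; z] (iota 1 3))
    (pi : 'S_n) :
  reflect (exists a b c : 'I_n, [/\ a < b, b < c, (pi a < pi b) = (x < y),
                                   (pi a < pi c) = (x < z)
                                 & (pi b < pi c) = (y < z)])
          (contains (@oneline [:: x; y; z] w_perm) pi).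
Proof.
have /= := perm_uniq w_perm; rewrite !inE !negb_or => /andP[/andP[xNy xNz]].
rewrite andbT => yNz.
have ltn_rev (i j : 'I_n) (u v : nat) : i != j -> u != v ->
    (pi i < pi j) = (u < v) -> (pi j < pi i) = (v < u).
  by move=> iNj uNv e; rewrite ltn_perm_antisym // e; case: ltngtP uNv.
apply: (iffP existsP) => [[f /andP[/forallP f_incr /forallP f_pat]]|].
  pose o (i : nat) (i3 : i < 3) : 'I_3 := Ordinal i3.
  have f_lt (i j : 'I_3) : i < j -> f i < f j.
    by move=> ij; move/forallP/(_ j)/implyP: (f_incr i); apply.
  have f_ord (i j : 'I_3) : (pi (f i) < pi (f j))
      = (nth 0 [:: x; y; z] i < nth 0 [:: x; y; z] j).
    by move/forallP/(_ j)/eqP: (f_pat i) => ->; exact: (@oneline_ltn [:: x; y; z]).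
  exists (f (o 0 isT)), (f (o 1 isT)), (f (o 2 isT)).
  by split; rewrite ?f_lt ?f_ord.
case=> a [b [c [ab bc eab eac ebc]]].
have ac := ltn_trans ab bc.
have neq (i j : 'I_n) : i < j -> i != j by rewrite ltn_neqAle => /andP[].
have eba := ltn_rev _ _ _ _ (neq _ _ ab) xNy eab.
have eca := ltn_rev _ _ _ _ (neq _ _ ac) xNz eac.
have ecb := ltn_rev _ _ _ _ (neq _ _ bc) yNz ebc.
exists [ffun i => nth a [:: a; b; c] (val i)].
apply/andP; split; apply/forallP=> i; apply/forallP=> j; rewrite !ffunE.
  by case: i j => [[|[|[|i]]] //= _] [[|[|[|j]]] //= _].
rewrite (@oneline_ltn [:: x; y; z]).
by case: i j => [[|[|[|i]]] //= _] [[|[|[|j]]] //= _]; rewrite ?ltnn //; apply/eqP.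
Qed.

Definition increasing_tail m (pi : 'S_m.+1) :=
  forall i j : 'I_m.+1, 0 < i -> i < j -> pi i < pi j.

Lemma avoids3_increasing_tail m (pi : 'S_m.+1) :
  reflect (increasing_tail pi)
    (all (fun alpha => avoids (projT2 alpha) pi) [:: p132; p231; p321]).
Proof.
apply: (iffP idP) => [/= /and4P[/contains3P n132 /contains3P n231 /contains3P n321 _]|].
  move=> b c b_gt0 bc; rewrite ltnNge; apply/negP => pi_cb.
  have pi_bc : (pi b < pi c) = false by rewrite ltnNge pi_cb.
  pose a : 'I_m.+1 := ord0; have ab : a < b by [].
  have [ac|ca] := ltnP (pi a) (pi c).
    by apply: n132; exists a, b, c; rewrite ac pi_bc (leq_trans ac).
  have pi_ac : (pi a < pi c) = false by rewrite ltnNge ca.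
  have [pi_ab|ba] := ltnP (pi a) (pi b).
    by apply: n231; exists a, b, c; rewrite pi_ab pi_ac pi_bc.
  by apply: n321; exists a, b, c; rewrite pi_ac pi_bc [pi a < _]ltnNge ba.
move=> pi_incr; apply/and4P; split=> //; apply/contains3P;
  case=> a [b [c [ab bc _ _]]];
  by rewrite pi_incr // (leq_ltn_trans _ ab).
Qed.

(** Nothing is moved down, since a strictly increasing sequence of naturals
    grows at least as fast as its index; the same holds of the inverse. *)
Lemma increasing_perm_id n (s : 'S_n) :
  (forall i j : 'I_n, i < j -> s i < s j) -> s = 1%g.
Proof.
have geq_id (t : 'S_n) : (forall i j : 'I_n, i < j -> t i < t j) ->
    forall i : 'I_n, i <= t i.
  move=> t_incr [i i_lt]; elim: i i_lt => [//|i IHi] i_lt.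
  by apply: leq_ltn_trans (IHi (ltnW i_lt)) _; apply: t_incr.
move=> s_incr; apply/permP=> i; rewrite perm1; apply/val_inj/eqP.
rewrite eqn_leq geq_id // andbT -{2}(permK s i) geq_id // => {}i j ij.
rewrite ltn_perm_antisym; last by rewrite neq_ltn ij orbT.
by apply/negP => /s_incr; rewrite !permKV ltnNge ltnW.
Qed.

(** The quotient of the two permutations fixes [0] and is increasing, hence is
    the identity. *)
Lemma increasing_tail_inj m (pi rho : 'S_m.+1) :
  increasing_tail pi -> increasing_tail rho -> pi ord0 = rho ord0 -> pi = rho.
Proof.
move=> pi_incr rho_incr eq0; apply/eqP; rewrite eq_mulgV1; apply/eqP.
set s := (pi * rho^-1)%g.
have s0 : s ord0 = ord0 by rewrite permM eq0 permK.
have s_gt0 (i : 'I_m.+1) : 0 < i -> 0 < s i.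
  rewrite !lt0n; apply: contraNneq => si0; have: s i = s ord0.
    by rewrite s0; apply/val_inj.
  by move/perm_inj->.
have rhos i : rho (s i) = pi i by rewrite permM permKV.
apply: increasing_perm_id => i j ij.
have [i0|i_gt0] := posnP i.
  have -> : i = ord0 by apply/val_inj.
  by rewrite s0 s_gt0 // (leq_ltn_trans _ ij).
rewrite ltn_perm_antisym; last by rewrite neq_ltn ij orbT.
apply/negP => /(rho_incr _ _ (s_gt0 _ (ltn_trans i_gt0 ij))).
by rewrite !rhos ltnNge ltnW // pi_incr.
Qed.

Lemma lift_perm_increasing_tail m (j : 'I_m.+1) :
  increasing_tail (lift_perm ord0 j 1).
Proof.
move=> a b; case: (unliftP ord0 a) => [k ->|-> //] _.
case: (unliftP ord0 b) => [l ->|-> //]; rewrite !lift_perm_lift !perm1 /=.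
rewrite /bump !leq0n !add1n ltnS => kl.
by case: leqP; case: leqP; lia.
Qed.

Lemma increasing_tailP m (pi : 'S_m.+1) :
  increasing_tail pi <-> pi = lift_perm ord0 (pi ord0) 1.
Proof.
split=> [pi_incr|->]; last exact: lift_perm_increasing_tail.
apply: increasing_tail_inj => //; first exact: lift_perm_increasing_tail.
by rewrite lift_perm_id.
Qed.

(** The position [lift ord0 k] is fixed exactly when the bump at [j] moves [k],
    that is when it lies beyond [j]. *)
Lemma card_fixed_points_lift_perm m (j : 'I_m.+1) :
  #|fixed_points (lift_perm ord0 j 1)| = if j == ord0 then m.+1 else m - j.
Proof.
have fixE (i : 'I_m.+1) : (i \in fixed_points (lift_perm ord0 j 1)) =
    if i == ord0 then j == ord0 else j < i.
  rewrite inE; case: (unliftP ord0 i) => [k ->|->].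
    rewrite lift_perm_lift perm1 -(inj_eq val_inj) /= /bump leq0n add1n ltnS.
    by case: leqP; rewrite ?eqxx // add0n => _; apply/negbTE; rewrite neq_ltn ltnSn.
  by rewrite lift_perm_id eqxx.
have [j0|j_neq0] := eqVneq j ord0.
  rewrite -[RHS]card_ord -cardsT; apply: eq_card => i; rewrite fixE inE j0 eqxx.
  by case: eqVneq => //; rewrite lt0n.
have -> : fixed_points (lift_perm ord0 j 1) = ~: [set i : 'I_m.+1 | i < j.+1].
  apply/setP=> i; rewrite fixE !inE -leqNgt.
  by case: eqVneq => // ->; apply/negbTE.
rewrite cardsCs setCK card_ord -sum1dep_card.
by rewrite -(@big_ord_widen _ _ _ j.+1 m.+1 (fun=> 1)) // sum1_card card_ord subSS.
Qed.

Lemma snk_card_first_letters m k :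
  snk m.+1 k [:: p132; p231; p321] =
  #|[set j : 'I_m.+1 | (if j == ord0 then m.+1 else m - j) == k]|.
Proof.
pose word (j : 'I_m.+1) := lift_perm ord0 j 1.
have word_inj : injective word.
  by move=> i j /(congr1 (fun pi : 'S_m.+1 => pi ord0)); rewrite !lift_perm_id.
rewrite -(card_imset _ word_inj); apply: eq_card => pi.
rewrite inE; apply/andP/imsetP => [[fix_k]|[j]].
  move/avoids3_increasing_tail/increasing_tailP=> piE.
  by exists (pi ord0); rewrite // inE -card_fixed_points_lift_perm -piE.
rewrite inE -card_fixed_points_lift_perm => fix_k ->; split=> //.
exact/avoids3_increasing_tail/lift_perm_increasing_tail.
Qed.

Theorem theorem3p8 (n : nat) (hn : 3 <= n) :
  [/\ (forall k : nat, k <= n - 2 -> snk n k [:: p132; p231; p321] = 1),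
      snk n (n - 1) [:: p132; p231; p321] = 0
    & snk n n [:: p132; p231; p321] = 1].
Proof.
case: n hn => // m m_gt1; split=> [k k_le||]; rewrite snk_card_first_letters.
- (* the first letter with [m - j = k]; it is positive because [k < m] *)
  rewrite -(cards1 (inord (m - k) : 'I_m.+1)); apply: eq_card => j; rewrite !inE.
  rewrite -!(inj_eq val_inj) /= inordK; last by lia.
  by have := ltn_ord j; move: (nat_of_ord j) => {}j; case: (eqVneq j 0); lia.
- apply/eqP; rewrite cards_eq0; apply/eqP/setP => j; rewrite !inE.
  rewrite -!(inj_eq val_inj) /=.
  by move: (nat_of_ord j) => {}j; case: (eqVneq j 0); lia.
rewrite -(cards1 (ord0 : 'I_m.+1)); apply: eq_card => j; rewrite !inE.
by case: (eqVneq j ord0); lia.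
Qed.
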